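(* Let $p>2$ be a prime number, let $n\geq0$ be an integer, let $G$ be a finite $p$-group, and let $C_1,\ldots,C_{p-1}$ be normal subgroups of $G$ such that $C_i\subsetneq G$ for all $1\leq i\leq p-1$ and $\displaystyle\max_{g\in G\setminus\left(\bigcup_{i=1}^{p-1}C_i\right)} b(g)\leq n$. Then there exists a normal subgroup $N$ of $G$ such that: (1) $\log_p|G:N|\leq n(n+2)$; (2) $N\not\subseteq\bigcup_{i=1}^{p-1}C_i$; (3) $\displaystyle cl(N)\leq 1+\max_{g\in N\setminus\left(\bigcup_{i=1}^{p-1}C_i\right)} b_N(g)$.
   Context: For $x\in G$, $b(x):=\log_p|G:Z_G(x)|$ where $Z_G(x)$ is the centralizer of $x$ in $G$. For a subgroup $K$ of $G$ and $g\in G$, $b_K(g):=\log_p|K:K\cap Z_G(g)|$. $cl(N)$ denotes the nilpotency class of $N$. *)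

(* Defs.v *)
From mathcomp Require Import all_boot all_fingroup all_solvable.
Set Implicit Arguments. Unset Strict Implicit. Unset Printing Implicit Defensive.
Local Open Scope group_scope.

Definition bG (gT : finGroupType) (p : nat) (G : {set gT}) (x : gT) : nat :=
  logn p #|G : 'C_G[x]|.

Definition bK (gT : finGroupType) (p : nat) (G K : {set gT}) (g : gT) : nat :=
  logn p #|K : K :&: 'C_G[g]|.

(* Main.v *)
Require Import Defs.
From mathcomp Require Import all_boot all_fingroup all_solvable.
From mathcomp Require Import zify.
Local Open Scope group_scope.

(** Enlarging the C_i, assume that they are maximal; let S be their union and,
for N normal in G and not inside S, let D_k be the centraliser in N of
γ_k(N)/γ_(k+2)(N). An element y of N outside j of the D_k has breadth at least
j, because the classes of y under the γ_k(N) shrink j times. A subgroup D of N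
satisfies 2|N : D||D \ S| <= p|N \ S|: each coset d(N ∩ C_1) with d in D \ S
has at least a 2/p fraction of its elements outside S. For D = D_k this gives
|N \ S| <= 2|N \ S \ D_k|, and summing over k gives cl(N) <= 2n + 1. If
cl(N) - 1 exceeds the breadth of every element of N \ S, then the D_k cover
N \ S, so one of them contains at least a 1/(2n) part of it and therefore
satisfies |N : D_k| <= pn, whence 2 log_p |N : D_k| <= n + 2. This D_k has smaller
class than N and is not inside S; replacing N by D_k at most 2n times, starting
from G, reaches the required subgroup at index at most p^(n(n+2)). *)

(** * Two-step centralisers of the lower central series, nilpotency class and breadth *)

Section TwoStepCentraliser.

Context {gT : finGroupType}.
Implicit Types G H K N : {group gT}.

(* Centralises γ_(k+1)(N)/γ_(k+3)(N), so that k counts from 0. *)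
Definition two_step_cent (N : {set gT}) (k : nat) : {set gT} :=
  [set y in N | [forall z in 'L_k.+1(N), [~ z, y] \in 'L_k.+3(N)]].

Lemma two_step_centP N k y :
  reflect (y \in N /\ forall z, z \in 'L_k.+1(N) -> [~ z, y] \in 'L_k.+3(N))
          (y \in two_step_cent N k).
Proof.
rewrite inE; apply: (iffP andP) => -[Ny h]; split=> //; first exact/forall_inP.
exact/forall_inP.
Qed.

Lemma two_step_cent_group_set N k : group_set (two_step_cent N k).
Proof.
apply/group_setP; split=> [|x y].
  by apply/two_step_centP; split=> // z _; rewrite commg1 group1.
case/two_step_centP=> Nx hx /two_step_centP[Ny hy].
apply/two_step_centP; split=> [|z Lz]; first exact: groupM.
rewrite commgMJ groupM ?hy // memJ_norm ?hx //.
exact: (subsetP (lcn_norm _ _)).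
Qed.

Canonical two_step_cent_group N k := Group (two_step_cent_group_set N k).

Lemma two_step_cent_sub N k : two_step_cent N k \subset N.
Proof. by apply/subsetP=> y /two_step_centP[]. Qed.

Lemma two_step_cent_normal G N k : N <| G -> two_step_cent N k <| G.
Proof.
move=> nsNG; have [sNG nNG] := andP nsNG.
have nLG j : G \subset 'N('L_j(N)).
  exact: normal_norm (char_normal_trans (lcn_char _ _) nsNG).
rewrite /normal (subset_trans (two_step_cent_sub _ _) sNG).
apply/subsetP=> g Gg; rewrite inE; apply/subsetP=> _ /imsetP[y Dy ->].
have [Ny hy] := two_step_centP _ _ _ Dy.
apply/two_step_centP; split=> [|z Lz].
  by rewrite memJ_norm ?(subsetP nNG).
rewrite -[z](conjgKV g) -conjRg memJ_norm ?(subsetP (nLG _)) //.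
by rewrite hy // memJ_norm // groupV (subsetP (nLG _)).
Qed.

Lemma commg_two_step_cent N k :
  [~: 'L_k.+1(N), two_step_cent N k] \subset 'L_k.+3(N).
Proof.
by rewrite gen_subG; apply/subsetP=> _ /imset2P[z y Lz /two_step_centP[_ hy] ->]; apply: hy.
Qed.

(** If all of [N] centralised the factor, ['L_k.+2(N)] would lie in [[~: 'L_k.+2(N), N]], so
    nilpotency would make it trivial. *)
Lemma two_step_cent_proper N k :
  nilpotent N -> k.+1 < nil_class N -> ~~ (N \subset two_step_cent N k).
Proof.
move=> nilN ltk; apply/negP=> sND.
have sL : 'L_k.+2(N) \subset [~: 'L_k.+2(N), N].
  have := subset_trans (commgS 'L_k.+1(N) sND) (commg_two_step_cent N k).
  by rewrite -!lcnSn.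
have L1 : 'L_k.+2(N) = 1.
  apply/eqP; move/forall_inP: nilN; apply; rewrite /= subsetI sL andbT.
  exact: lcn_sub.
by move/lcn_nil_classP: L1 => /(_ nilN); rewrite leqNgt ltk.
Qed.

(** From term [k.+2] on, the lower central series of the centraliser runs one step ahead of that of
    [N]. *)
Lemma nil_class_two_step_cent N k :
  nilpotent N -> k.+1 < nil_class N ->
  nil_class (two_step_cent N k) < nil_class N.
Proof.
move=> nilN ltk; have sDN := two_step_cent_sub N k.
have nilD := nilpotentS sDN nilN.
have sL j : 'L_(j + k.+2)(two_step_cent N k) \subset 'L_(j + k.+3)(N).
  elim: j => [|j IHj]; rewrite ?add0n ?addSn.
    rewrite lcnSn; apply: subset_trans (commg_two_step_cent N k).
    exact: commSg (lcnS _ sDN).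
  by move: IHj; rewrite !addnS => IHj; exact: commgSS IHj sDN.
have /(lcn_nil_classP _ nilN) cN : nil_class N <= nil_class N by [].
have [m def_m] : exists m, nil_class N = (m + k).+2.
  by exists (nil_class N - k.+2)%N; rewrite -2!addnS subnK.
rewrite def_m ltnS; apply/(lcn_nil_classP _ nilD)/trivgP.
by rewrite -cN def_m; have := sL m; rewrite !addnS.
Qed.

Lemma pnat_class p K y : p.-group K -> p.-nat #|y ^: K|.
Proof. by rewrite -index_cent1; apply: pnat_dvd (dvdn_indexg _ _). Qed.

Lemma leq_logn_class p H K y :
  prime p -> p.-group K -> H \subset K ->
  logn p #|y ^: H| <= logn p #|y ^: K|.
Proof.
move=> p_pr pK sHK; have := subset_leq_card (imsetS (conjg y) sHK).
have [a ->] := p_natP (pnat_class p H y (pgroupS sHK pK)).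
have [b ->] := p_natP (pnat_class p K y pK).
by rewrite !pfactorK // leq_exp2l // prime_gt1.
Qed.

(** If the two classes of [y] coincide, each [y ^ x] with [x] in ['L_k.+1(N)] is some [y ^ z] with
    [z] in ['L_k.+2(N)], so [[~ y, x] = [~ y, z]] lies in ['L_k.+3(N)] and [y] is in the
    centraliser. Otherwise the class shrinks, and by a factor of at least [p], both sizes being
    powers of [p]. *)
Lemma two_step_cent_jump p N k y :
  prime p -> p.-group N -> y \in N ->
  (y \notin two_step_cent N k) + logn p #|y ^: 'L_k.+2(N)|
    <= logn p #|y ^: 'L_k.+1(N)|.
Proof.
move=> p_pr pN Ny.
have sL : y ^: 'L_k.+2(N) \subset y ^: 'L_k.+1(N) by apply/imsetS/lcn_subS.
have pcl j : {e | #|y ^: 'L_j(N)| = p ^ e}%N.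
  exact/p_natP/(pnat_class p _ y)/(pgroupS (lcn_sub j N)).
have : (y \notin two_step_cent N k) + #|y ^: 'L_k.+2(N)| <= #|y ^: 'L_k.+1(N)|.
  have [_|nDy] /= := boolP (y \in _); first exact: subset_leq_card.
  rewrite add1n ltn_neqAle subset_leq_card // andbT.
  apply: contra nDy => /eqP eqL.
  have {}eqL : y ^: 'L_k.+2(N) = y ^: 'L_k.+1(N).
    by apply/eqP; rewrite eqEcard sL eqL leqnn.
  apply/two_step_centP; split=> // x Lx.
  have: y ^ x \in y ^: 'L_k.+2(N) by rewrite eqL memJ_class.
  case/imsetP=> z Lz def_yx.
  rewrite lcnSn -invg_comm groupV commgEl def_yx -commgEl -invg_comm groupV.
  exact: mem_commg.
have [a ->] := pcl k.+2; have [b ->] := pcl k.+1; rewrite !pfactorK //.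
by case: (y \in _); rewrite ?ltn_exp2l ?leq_exp2l ?prime_gt1.
Qed.

Lemma sum_two_step_cent_breadth p N m y :
  prime p -> p.-group N -> y \in N ->
  \sum_(k < m) (y \notin two_step_cent N k) <= logn p #|y ^: N|.
Proof.
move=> p_pr pN Ny.
(* Keeping the last class in the sum makes the jumps telescope, starting from ['L_1(N) = N]. *)
suffices: \sum_(k < m) (y \notin two_step_cent N k)
          + logn p #|y ^: 'L_m.+1(N)| <= logn p #|y ^: N|.
  exact/leq_trans/leq_addr.
elim: m => [|m IHm]; first by rewrite big_ord0.
apply: leq_trans IHm; rewrite big_ord_recr /= -addnA leq_add2l.
exact: two_step_cent_jump.
Qed.

End TwoStepCentraliser.

(** * Counting the elements of cosets and subgroups outside a union of subgroups *)

Lemma lcosetI_eq (gT : finGroupType) (H K : {group gT}) d x :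
  x \in (d *: K) :&: H -> (d *: K) :&: H = x *: (K :&: H).
Proof.
case/setIP=> dKx Hx; apply/setP=> y.
rewrite -(lcoset_eqP dKx) in_setI !mem_lcoset in_setI.
by congr (_ && _); rewrite groupMl ?groupV.
Qed.

Lemma leq_card_bigcup (I T : finType) (F : I -> {set T}) :
  #|\bigcup_i F i| <= \sum_i #|F i|.
Proof.
elim/big_rec2: _ => [|i m A _ le_A]; first by rewrite cards0.
by apply: leq_trans (leq_card_setU _ _) _; rewrite leq_add2l.
Qed.

Section AvoidingCosets.

Variables (gT : finGroupType) (p q : nat) (N : {group gT}).
Variable M : 'I_q.+1 -> {group gT}.
Hypotheses (p_pr : prime p) (pN : p.-group N) (lt_qp : q.+1 < p).
Hypothesis indexNM : forall i, #|N : N :&: M i| = p.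

Let S := \bigcup_(i < q.+1) M i.
Let K := (N :&: M ord0)%G.

(** The coset [d *: K] misses [M ord0] and meets each of the [q] other [M i] in at most [#|K| / p]
    elements. This leaves at least [(p - q) / p] of it, and [p - q] is at least 2. *)
Lemma lcoset_avoid d : d \in N :\: S -> 2 * #|K| <= p * #|(d *: K) :\: S|.
Proof.
rewrite inE => /andP[nSd Nd].
have nMd i : d \notin M i by apply: contra nSd => Md; apply/bigcupP; exists i.
have small i : #|(d *: K) :&: M i| * p <= #|K|.
  have [->|/set0Pn[x /setIP[dKx Mx]]] := eqVneq ((d *: K) :&: M i) set0.
    by rewrite cards0.
  have -> : (d *: K) :&: M i = x *: (K :&: M i) by apply/lcosetI_eq/setIP.
  rewrite card_lcoset -(LagrangeI K (M i)) leq_mul2l.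
  (* If [K] lay in [M i], then so would [x *: K], which contains [d]. *)
  have: #|K : M i| != 1%N.
    rewrite indexg_eq1; apply: contra (nMd i) => sKM.
    have: d \in x *: K by rewrite (lcoset_eqP dKx) lcoset_refl.
    by case/lcosetP=> y /(subsetP sKM) My ->; rewrite groupM.
  have: p.-nat #|K : M i| by exact: pnat_dvd (dvdn_indexg _ _) (pgroupS (subsetIl _ _) pN).
  case/p_natP=> [[|e] ->]; rewrite ?expn0 // expnS => _.
  by rewrite leq_pmulr ?orbT // expn_gt0 prime_gt0.
have sub : d *: K \subset ((d *: K) :\: S) :|: \bigcup_(i < q) ((d *: K) :&: M (lift ord0 i)).
  apply/subsetP=> x dKx; rewrite inE in_setD dKx andbT -implyNb negbK.
  apply/implyP=> /bigcupP[i _ Mx]; apply/bigcupP.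
  case: (unliftP ord0 i) Mx => [j|] -> Mx; first by exists j; rewrite // inE dKx.
  case/lcosetP: dKx Mx => k /setIP[_ Mk] -> Mdk.
  by have := nMd ord0; rewrite -(groupMr _ Mk) Mdk.
have := leq_trans (subset_leq_card sub) (leq_card_setU _ _).
rewrite card_lcoset => leK.
have leU : #|\bigcup_(i < q) ((d *: K) :&: M (lift ord0 i))| * p <= q * #|K|.
  apply: leq_trans (_ : (\sum_(i < q) #|(d *: K) :&: M (lift ord0 i)|) * p <= _).
    by rewrite leq_mul2r leq_card_bigcup orbT.
  have ->: (q * #|K| = \sum_(i < q) #|K|)%N by rewrite sum_nat_const card_ord.
  by rewrite big_distrl leq_sum.
suffices arith a b c : c <= a + b -> b * p <= q * c -> 2 * c <= p * a.
  exact: arith leK leU.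
move=> le_c le_b; have := leq_mul (leqnn p) le_c.
have := leq_mul lt_qp (leqnn c); nia.
Qed.

(** Double counting: every coset [d *: K] with [d] in [H :\: S] has many points outside [S], while a
    given point is reached from at most [#|K :&: H|] such [d]. Since [K] is maximal in [N] and does
    not contain [H], [K * H = N], which converts [#|K|] into [#|N : H| * #|K :&: H|]. *)
Lemma card_avoid (H : {group gT}) : H \subset N ->
  #|N : H| * (2 * #|H :\: S|) <= p * #|N :\: S|.
Proof.
move=> sHN; have [->|/set0Pn[h]] := eqVneq (H :\: S) set0.
  by rewrite cards0 !muln0.
rewrite inE => /andP[nSh Hh].
have sKN : K \subset N := subsetIl _ _.
have maxK : maximal K N by apply: p_index_maximal; rewrite ?indexNM.
have nKH : ~~ (H \subset K).
  apply: contra nSh => /subsetP/(_ h Hh)/setIP[_ Mh].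
  by apply/bigcupP; exists ord0.
have defKH := mulg_normal_maximal (p_maximal_normal pN maxK) maxK sHN nKH.
have cardNH : #|K| = (#|N : H| * #|K :&: H|)%N.
  apply/eqP; rewrite -(eqn_pmul2r (cardG_gt0 H)) mul_cardG defKH.
  by rewrite -(Lagrange sHN) -mulnA mulnC.
(* Counts the pairs (d, x) with d in H \ S and x in dK \ S. *)
have count : #|H :\: S| * (2 * #|K|) <= p * (#|N :\: S| * #|K :&: H|).
  have: \sum_(d in H :\: S) 2 * #|K| <= \sum_(d in H :\: S) p * #|(d *: K) :\: S|.
    apply: leq_sum => d; rewrite inE => /andP[nSd Hd].
    by apply: lcoset_avoid; rewrite inE nSd (subsetP sHN).
  rewrite sum_nat_const -big_distrr /= => /leq_trans; apply.
  rewrite leq_mul2l -sum_nat_const; apply/orP; right.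
  under eq_bigr => d _ do rewrite -sum1_card.
  rewrite (exchange_big_dep (mem (N :\: S))) /=; last first.
    move=> d x; rewrite !in_setD mem_lcoset => /andP[_ Hd] /andP[-> Kx] /=.
    by rewrite -(mulKVg d x) groupM ?(subsetP sHN d Hd) ?(subsetP sKN _ Kx).
  apply: leq_sum => x _; rewrite sum1_card.
  apply: leq_trans (_ : #|(x *: K) :&: H| <= _).
    apply/subset_leq_card/subsetP=> d.
    rewrite unfold_in => /andP[/setDP[Hd _] /setDP[]].
    rewrite mem_lcoset => Kx _; rewrite inE mem_lcoset Hd andbT.
    by rewrite -groupV invMg invgK.
  have [->|/set0Pn[y /lcosetI_eq->]] := eqVneq ((x *: K) :&: H) set0.
    by rewrite cards0.
  by rewrite card_lcoset.
rewrite -(leq_pmul2r (cardG_gt0 (K :&: H))).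
move: count; rewrite cardNH.
suffices arith a b c d : a * (2 * (b * c)) <= p * (d * c) -> b * (2 * a) * c <= p * d * c.
  exact: arith.
by lia.
Qed.

End AvoidingCosets.

(** * Descent from [G] through two-step centralisers, for maximal subgroups [M i] *)

Lemma double_lt_expn p e : 2 < p -> 2 * e < p ^ e.
Proof.
move=> p_gt2; elim: e => [|e IHe]; first by rewrite muln0 expn0.
rewrite expnS; apply: leq_trans (leq_mul p_gt2 (leqnn _)).
by move: IHe; set x := (p ^ e)%N; lia.
Qed.

Section Descent.

Variables (gT : finGroupType) (p q n : nat) (G : {group gT}).
Variable M : 'I_q.+1 -> {group gT}.
Hypotheses (p_pr : prime p) (p_gt2 : 2 < p) (pG : p.-group G) (lt_qp : q.+1 < p).
Hypothesis maxM : forall i, maximal (M i) G.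

Let S := \bigcup_(i < q.+1) M i.

(** Fewer than [p] subgroups of order [#|G| / p] cannot cover [G]. *)
Lemma not_sub_bigcup_maximal : ~~ (G \subset S).
Proof.
apply/negP=> /subset_leq_card; apply/negP; rewrite -ltnNge.
rewrite -(ltn_pmul2r (prime_gt0 p_pr)).
apply: leq_ltn_trans (_ : (\sum_(i < q.+1) #|M i|) * p < _).
  by rewrite leq_mul2r leq_card_bigcup orbT.
rewrite big_distrl /= (eq_bigr (fun=> #|G|)) => [|i _].
  by rewrite sum_nat_const card_ord mulnC ltn_pmul2l.
by rewrite -(p_maximal_index pG (maxM i)) Lagrange ?(proper_sub (maxgroupp (maxM i))).
Qed.

Lemma index_setI_maximal (N : {group gT}) i :
  N \subset G -> ~~ (N \subset S) -> #|N : N :&: M i| = p.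
Proof.
move=> sNG nNS; have nNM : ~~ (N \subset M i).
  by apply: contra nNS => /subset_trans; apply; apply: (bigcup_sup i).
have defG := mulg_normal_maximal (p_maximal_normal pG (maxM i)) (maxM i) sNG nNM.
apply/eqP; rewrite indexgI -(eqn_pmul2l (cardG_gt0 (M i))) LagrangeMl defG.
by rewrite -(p_maximal_index pG (maxM i)) Lagrange ?(proper_sub (maxgroupp (maxM i))).
Qed.

Section Step.

Variable N : {group gT}.
Hypotheses (nsNG : N <| G) (nNS : ~~ (N \subset S)).
Hypothesis breadthN : forall y, y \in N :\: S -> logn p #|y ^: N| <= n.

Let sNG : N \subset G := normal_sub nsNG.
Let pN : p.-group N := pgroupS sNG pG.
Let nilN : nilpotent N := pgroup_nil pN.
Let D k := two_step_cent_group N k.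
(** The indices [k < m] are those with [k.+1 < nil_class N], where [D k] is proper in [N] and of
    smaller class. *)
Let m := (nil_class N).-1.

Let lt_m k : k < m -> k.+1 < nil_class N.
Proof. by rewrite -ltnS /m; case: (nil_class N). Qed.

Let card_avoidD k : #|N : D k| * (2 * #|D k :\: S|) <= p * #|N :\: S|.
Proof.
apply: card_avoid => // [i|]; first exact: index_setI_maximal.
exact: two_step_cent_sub.
Qed.

Let NS_gt0 : 0 < #|N :\: S|.
Proof. by rewrite card_gt0 setD_eq0. Qed.

Let setDS k : (N :\: S) :&: D k = D k :\: S.
Proof. by rewrite setIDAC (setIidPr (two_step_cent_sub N k)). Qed.

Let sum_mem (A : {set gT}) (B : 'I_m -> {set gT}) :
  \sum_(y in A) \sum_(k < m) (y \in B k) = \sum_(k < m) #|A :&: B k|.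
Proof.
rewrite exchange_big; apply: eq_bigr => k _.
by rewrite -sum1_card [RHS]big_mkcond [LHS]big_mkcond;
  apply: eq_bigr => y _; rewrite inE; case: (y \in A); case: (y \in B k).
Qed.

(** For [k < m], the index of [D k] is at least [p], so at least half of [N :\: S] lies outside
    [D k]; yet each element lies outside at most [n] of the [D k]. Averaging gives [m <= 2 * n]. *)
Lemma nil_class_avoid : nil_class N <= (2 * n).+1.
Proof.
suffices: m <= 2 * n by rewrite /m; case: (nil_class N).
rewrite -(leq_pmul2r NS_gt0).
have half k : k < m -> #|N :\: S| <= 2 * #|(N :\: S) :&: ~: D k|.
  move/lt_m=> lt_k; have nND := two_step_cent_proper _ _ nilN lt_k.
  have le_p : p <= #|N : D k|.
    have [[|e] def_i] := p_natP (pnat_dvd (dvdn_indexg N (D k)) pN).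
      by case/negP: nND; rewrite -indexg_eq1 def_i.
    by rewrite def_i expnS leq_pmulr // expn_gt0 prime_gt0.
  have := leq_trans (leq_mul le_p (leqnn _)) (card_avoidD k).
  rewrite leq_pmul2l ?prime_gt0 // -setDS -setDE.
  have := cardsID (D k) (N :\: S); lia.
have: \sum_(y in N :\: S) \sum_(k < m) (y \in ~: D k) <= \sum_(y in N :\: S) n.
  apply: leq_sum => y NSy; apply: leq_trans (breadthN _ NSy).
  under eq_bigr => k _ do rewrite inE.
  by apply: sum_two_step_cent_breadth => //; case/setDP: NSy.
rewrite sum_mem sum_nat_const => le_n.
have: \sum_(k < m) #|N :\: S| <= \sum_(k < m) 2 * #|(N :\: S) :&: ~: D k|.
  by apply: leq_sum => k _; apply: half.
rewrite -big_distrr sum_nat_const card_ord /= => /leq_trans; apply.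
by rewrite -mulnA leq_mul2l mulnC.
Qed.

Lemma exists_cheap_two_step_cent :
  1 + \max_(g in N :\: S) logn p #|g ^: N| < nil_class N ->
  exists k, [/\ k.+1 < nil_class N, ~~ (D k \subset S)
               & 2 * logn p #|N : D k| <= n + 2].
Proof.
move=> lt_c; have lt_max : \max_(g in N :\: S) logn p #|g ^: N| < m.
  by move: lt_c; rewrite /m add1n; case: (nil_class N).
have cover y : y \in N :\: S -> 1 <= \sum_(k < m) (y \in D k).
  move=> NSy; have Ny : y \in N by case/setDP: NSy.
  have lt_b : logn p #|y ^: N| < m.
    by apply: leq_ltn_trans lt_max; apply: (@leq_bigmax_cond _ _ (fun g => logn p #|g ^: N|)).
  rewrite lt0n; apply: contraL lt_b => /eqP sum0; rewrite -leqNgt.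
  apply: leq_trans (sum_two_step_cent_breadth _ _ m _ p_pr pN Ny).
  (* Adding the vanishing sum of memberships turns every term into 1, so the total is [m]. *)
  rewrite -[leqRHS]addn0 -[X in _ + X]sum0 -big_split /=.
  rewrite -[leqLHS](card_ord m) -sum1_card; apply: leq_sum => k _.
  by case: (y \in _).
have le_sum : #|N :\: S| <= \sum_(k < m) #|D k :\: S|.
  rewrite -sum1_card (leq_trans (leq_sum _ cover)) // sum_mem.
  by under eq_bigr => k _ do rewrite setDS.
have [k le_k] : exists k : 'I_m, #|N :\: S| <= m * #|D k :\: S|.
  apply/existsP; apply: contraLR le_sum; rewrite negb_exists -ltnNge => /forallP lt_k.
  have m_gt0 : 0 < m by apply: leq_ltn_trans lt_max.
  (* Pigeonhole by contradiction: the [+ 1] records strictness, and [m_gt0] keeps it in the sum. *)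
  have: \sum_(k < m) (m * #|D k :\: S| + 1) <= \sum_(k < m) #|N :\: S|.
    by apply: leq_sum => k _; rewrite addn1 ltnNge lt_k.
  rewrite big_split -big_distrr /= !sum_nat_const card_ord; nia.
have lt_k := lt_m k (ltn_ord k); exists k; split=> //.
  rewrite -setD_eq0; apply: contraTN le_k => /eqP->.
  by rewrite cards0 muln0 -ltnNge.
have le_m : m <= 2 * n by have := nil_class_avoid; rewrite /m; case: (nil_class N).
have [b def_i] := p_natP (pnat_dvd (dvdn_indexg N (D k)) pN).
have le_pb : p ^ b <= p * n.
  have DS_gt0 : 0 < 2 * #|D k :\: S|.
    by rewrite muln_gt0; case: #|D k :\: S| le_k => //; rewrite muln0 leqNgt NS_gt0.
  rewrite -(leq_pmul2r DS_gt0) -def_i.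
  apply: leq_trans (card_avoidD k) _; rewrite -mulnA leq_mul2l; apply/orP; right.
  apply: leq_trans le_k _; rewrite mulnA [(n * 2)%N]mulnC leq_mul2r le_m.
  exact: orbT.
(* For [b = e.+1], cancelling [p] leaves [p ^ e <= n]; then [2 * e < n], hence the bound [n + 2] on
   [2 * b]. *)
rewrite def_i pfactorK //; case: b le_pb {def_i} => [|e]; first by rewrite muln0.
rewrite expnS leq_pmul2l ?prime_gt0 // => le_e.
have := leq_trans (double_lt_expn p e p_gt2) le_e; lia.
Qed.

End Step.

(** Here [j] bounds the number of replacements left: each lowers the class, and class at most 1
    meets the goal outright. The same [n] serves throughout because breadth does not grow in
    subgroups. The factor 2 avoids halving [n + 2]. *)
Lemma exists_normal_descent (j : nat) (N : {group gT}) :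
  N <| G -> ~~ (N \subset S) ->
  (forall y, y \in N :\: S -> logn p #|y ^: N| <= n) ->
  nil_class N <= j.+1 ->
  exists N' : {group gT},
    [/\ N' <| G, N' \subset N, ~~ (N' \subset S),
        2 * logn p #|N : N'| <= j * (n + 2)
      & nil_class N' <= 1 + \max_(g in N' :\: S) logn p #|g ^: N'|].
Proof.
elim: j N => [|j IHj] N nsNG nNS bN le_c.
  by exists N; split=> //; rewrite ?indexgg ?logn1 // (leq_trans le_c).
have [le_max | lt_max] := leqP (nil_class N) (1 + \max_(g in N :\: S) logn p #|g ^: N|).
  by exists N; split=> //; rewrite indexgg logn1.
have [k [lt_k nDS le_b]] := exists_cheap_two_step_cent N nsNG nNS bN lt_max.
set D := two_step_cent_group N k in nDS le_b.
have pN := pgroupS (normal_sub nsNG) pG.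
have sDN : D \subset N := two_step_cent_sub N k.
have nsDG : D <| G := two_step_cent_normal G N k nsNG.
have bD y : y \in D :\: S -> logn p #|y ^: D| <= n.
  case/setDP=> Dy nSy; apply: leq_trans (bN y _).
    exact: leq_logn_class.
  by rewrite inE nSy (subsetP sDN).
have le_cD : nil_class D <= j.+1.
  have := nil_class_two_step_cent N k (pgroup_nil pN) lt_k.
  by move/leq_trans/(_ le_c).
have [N' [nsN'G sN'D nN'S le_b' le_c']] := IHj D nsDG nDS bD le_cD.
exists N'; split=> //; first exact: subset_trans sDN.
rewrite -(Lagrange_index sDN sN'D) lognM ?indexg_gt0 //.
by rewrite mulnDr mulSn leq_add.
Qed.

End Descent.

(** * Reduction of the theorem to maximal subgroups *)

Theorem theorem3 (gT : finGroupType) (p n : nat) (G : {group gT})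
    (C : 'I_p.-1 -> {group gT}) :
  prime p -> (2 < p)%N -> p.-group G ->
  (forall i, C i <| G) ->
  (forall i, C i \proper G) ->
  (\max_(g in G :\: \bigcup_(i < p.-1) C i) bG p G g <= n)%N ->
  exists N : {group gT},
    [/\ N <| G,
        (logn p #|G : N| <= n * (n + 2))%N,
        ~~ (N \subset \bigcup_(i < p.-1) C i)
      & (nil_class N <= 1 + \max_(g in N :\: \bigcup_(i < p.-1) C i) bK p G N g)%N].
Proof.
move=> p_pr p_gt2 pG _ prC bC.
have [q def_q] : exists q, p.-1 = q.+1 by exists p.-2; case: (p) p_gt2 => [|[]].
have lt_qp : q.+1 < p by rewrite -def_q prednK ?prime_gt0.
rewrite def_q in C prC bC *.
have exM i : exists Mi : {group gT}, maximal Mi G /\ C i \subset Mi.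
  have [eqCG|[Mi]] := maximal_exists (proper_sub (prC i)); last by exists Mi.
  by have := prC i; rewrite eqCG properxx.
have [M /all_and2[maxM sCM]] := fin_all_exists exM.
set S := \bigcup_(i < q.+1) C i in bC *.
pose T := \bigcup_(i < q.+1) M i.
(* Passing from [S] to [T] shrinks complements: the breadth bound survives on [G :\: T], and a
   maximum over [N :\: T] is at most the one over [N :\: S]. *)
have sST : S \subset T.
  apply/bigcupsP=> i _; exact: subset_trans (sCM i) (bigcup_sup i _).
have bM y : y \in G :\: T -> logn p #|y ^: G| <= n.
  case/setDP=> Gy nTy; rewrite -index_cent1; apply: leq_trans bC.
  apply: (@leq_bigmax_cond _ _ (bG p G)).
  by rewrite inE Gy andbT; apply: contra nTy; apply: (subsetP sST).
have nGT : ~~ (G \subset T) by apply: not_sub_bigcup_maximal p_pr pG lt_qp maxM.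
(* The class bound for [G] itself allows [2 * n] replacements. *)
have [N [nsNG sNG nNT le_b le_c]] :=
  exists_normal_descent gT p q n G M p_pr p_gt2 pG lt_qp maxM (2 * n) G
    (normal_refl G) nGT bM
    (nil_class_avoid gT p q n G M p_pr p_gt2 pG lt_qp maxM G (normal_refl G) nGT bM).
exists N; split=> //.
- by rewrite -(@leq_pmul2l 2) // mulnA.
- by apply: contra nNT => /subset_trans; apply.
apply: leq_trans le_c _; rewrite leq_add2l.
apply/bigmax_leqP=> y /setDP[Ny nTy].
apply: leq_trans (_ : bK p G N y <= _).
  by rewrite /bK setIA (setIidPl sNG) index_cent1.
apply: (@leq_bigmax_cond _ _ (bK p G N)).
by rewrite inE Ny andbT; apply: contra nTy; apply: (subsetP sST).
Qed.
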